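(* For a tame semicascade $(\Omega,\varphi)$, all operators $P\in\Gamma(\Omega,\varphi)$ are regular; that is, for every $P\in\Gamma(\Omega,\varphi)$ the map $p=\pi P:\Omega\to\Omega$ is Borel and $(P\mu)(e)=\mu(p^{-1}e)$ for every Borel probability measure $\mu$ on $\Omega$ and every Borel set $e\subset\Omega$.
   Context: $\Omega$ is a metrizable compact space and $\varphi:\Omega\to\Omega$ is a continuous (not necessarily invertible) map; $(\Omega,\varphi)$ is the corresponding semicascade. $X=C(\Omega)$ is the Banach space of continuous scalar functions, $X^*$ its dual (Borel measures on $\Omega$), with pairing $(x,\mu)=\int_\Omega x\,d\mu$. $U\in\mathrm{End}\,X$ is $(Ux)(\omega)=x(\varphi\omega)$, $V=U^*\in\mathrm{End}\,X^*$; $\mathrm{End}$ denotes bounded linear operators. The $\mathrm{W}^*\mathrm{O}$-topology on $\mathrm{End}\,X^*$: $T_\alpha\to T$ iff $(x,T_\alpha y)\to(x,Ty)$ for all $x\in X$, $y\in X^*$. $\Gamma(\Omega,\varphi)$ is the $\mathrm{W}^*\mathrm{O}$-closure of $\{V^n:n\ge0\}$. $E(\Omega,\varphi)$ is the closure of $\{\varphi^n:n\ge0\}$ in $\Omega^\Omega$ with the topology of pointwise convergence. The canonical epimorphism $\pi:\Gamma(\Omega,\varphi)\to E(\Omega,\varphi)$, $P\mapsto p$, is determined by $P\delta(\omega)=\delta(p\,\omega)$ for all $\omega\in\Omega$, where $\delta(\omega)$ is the Dirac measure at $\omega$. The semicascade is tame if, for each $x\in C(\Omega)$ and each increasing sequence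 $\{n(k)\}$ of positive integers, $\inf_a\|\sum_{k\ge 1}a_kx_{n(k)}\|_{C(\Omega)}=0$, where $x_n(\omega)=x(\varphi^n\omega)$ and the infimum is over finite (finitely supported) real sequences $a=\{a_k\}$ with $\sum_k|a_k|=1$. *)

(* Defs.v *)
From HB Require Import structures.
From mathcomp Require Import all_boot all_order all_algebra.
From mathcomp Require Import all_classical all_reals all_analysis.
From mathcomp Require Import lra.

Set Implicit Arguments.
Unset Strict Implicit.
Unset Printing Implicit Defensive.

Import Order.TTheory GRing.Theory Num.Theory.
Import numFieldTopology.Exports numFieldNormedType.Exports.

Local Open Scope classical_set_scope.
Local Open Scope ring_scope.

(* The library attaches sigma-algebras to pointed types only, hence a nonempty
   metric space. The topology is the only part of the metric used below. *)
#[short(type="pointedMetricType")]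
HB.structure Definition PointedMetric (R : numDomainType) :=
  { T of Pointed T & Metric R T }.

Section bounded_operators.
Context {R : realType}.

Record blin (V W : normedModType R) := Blin {
  blin_fun :> V -> W ;
  blin_linear : linear blin_fun ;
  blin_bounded : exists M : R, forall x, `|blin_fun x| <= M * `|x| }.

Section structure.
Context {V W : normedModType R}.
Local Notation L := (blin V W).
Implicit Types f g : L.

HB.instance Definition _ f := GRing.isLinear.Build R V W *:%R f (blin_linear f).

Lemma blinP f g : f =1 g -> f = g.
Proof.
case: f g => [f lf bf] [g lg bg] /= /funext fg.
by subst g; congr Blin; exact: Prop_irrelevance.
Qed.

Lemma blin_boundE f : exists2 M : R, 0 <= M & forall x, `|f x| <= M * `|x|.
Proof.
have [M hM] := blin_bounded f; exists `|M| => // x.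
by rewrite (le_trans (hM x))// ler_wpM2r// ler_norm.
Qed.

HB.instance Definition _ := gen_eqMixin L.
HB.instance Definition _ := gen_choiceMixin L.

Fact blin0_linear : linear ((fun=> 0) : V -> W).
Proof. by move=> a x y; rewrite scaler0 addr0. Qed.
Fact blin0_bounded : exists M : R, forall x : V, `|0 : W| <= M * `|x|.
Proof. by exists 0 => x; rewrite normr0 mul0r. Qed.
Definition blin0 : L := Blin blin0_linear blin0_bounded.

Fact blinD_linear f g : linear (fun x => f x + g x).
Proof. by move=> a x y; rewrite !linearP scalerDr addrACA. Qed.
Fact blinD_bounded f g : exists M : R, forall x, `|f x + g x| <= M * `|x|.
Proof.
have [[M _ hM] [N _ hN]] := (blin_boundE f, blin_boundE g); exists (M + N) => x.
by rewrite (le_trans (ler_normD _ _))// mulrDl lerD.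
Qed.
Definition blinD f g : L := Blin (blinD_linear f g) (blinD_bounded f g).

Fact blinZ_linear (c : R) f : linear (fun x => c *: f x).
Proof. by move=> a x y; rewrite linearP scalerDr !scalerA mulrC. Qed.
Fact blinZ_bounded (c : R) f : exists M : R, forall x, `|c *: f x| <= M * `|x|.
Proof.
have [M _ hM] := blin_boundE f; exists (`|c| * M) => x.
by rewrite normrZ -mulrA ler_wpM2l.
Qed.
Definition blinZ (c : R) f : L := Blin (blinZ_linear c f) (blinZ_bounded c f).

Definition blinN f : L := blinZ (-1) f.

Fact blinDA : associative blinD.
Proof. by move=> f g h; apply: blinP => x /=; rewrite addrA. Qed.
Fact blinDC : commutative blinD.
Proof. by move=> f g; apply: blinP => x /=; rewrite addrC. Qed.
Fact blin0D : left_id blin0 blinD.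
Proof. by move=> f; apply: blinP => x /=; rewrite add0r. Qed.
Fact blinND : left_inverse blin0 blinN blinD.
Proof. by move=> f; apply: blinP => x /=; rewrite scaleN1r addNr. Qed.

HB.instance Definition _ := GRing.isZmodule.Build L blinDA blinDC blin0D blinND.

Fact blinZA a b f : blinZ a (blinZ b f) = blinZ (a * b) f.
Proof. by apply: blinP => x /=; rewrite scalerA. Qed.
Fact blinZ1 : left_id 1 blinZ.
Proof. by move=> f; apply: blinP => x /=; rewrite scale1r. Qed.
Fact blinZDr : right_distributive blinZ +%R.
Proof. by move=> a f g; apply: blinP => x /=; rewrite scalerDr. Qed.
Fact blinZDl f : {morph blinZ^~ f : a b / a + b}.
Proof. by move=> a b; apply: blinP => x /=; rewrite scalerDl. Qed.

HB.instance Definition _ :=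
  GRing.Zmodule_isLmodule.Build R L blinZA blinZ1 blinZDr blinZDl.

Definition opnorm_bounds f :=
  [set M : R | 0 <= M /\ forall x, `|f x| <= M * `|x|].
Definition opnorm f := inf (opnorm_bounds f).

Fact has_inf_opnorm f : has_inf (opnorm_bounds f).
Proof.
split; first by have [M M0 hM] := blin_boundE f; exists M.
by exists 0 => M [].
Qed.

Lemma opnorm_ge0 f : 0 <= opnorm f.
Proof. by apply: lb_le_inf; [exact: (has_inf_opnorm f).1|move=> M []]. Qed.

Lemma opnorm_le f (M : R) :
  0 <= M -> (forall x, `|f x| <= M * `|x|) -> opnorm f <= M.
Proof. by move=> M0 hM; apply: ge_inf; [exact: (has_inf_opnorm f).2|]. Qed.

Lemma le_opnorm f x : `|f x| <= opnorm f * `|x|.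
Proof.
have [->|x0] := eqVneq x 0; first by rewrite linear0 !normr0 mulr0.
rewrite -ler_pdivrMr ?normr_gt0//.
apply: lb_le_inf; first exact: (has_inf_opnorm f).1.
by move=> M [_ hM]; rewrite ler_pdivrMr ?normr_gt0.
Qed.

Fact opnormD f g : opnorm (f + g) <= opnorm f + opnorm g.
Proof.
apply: opnorm_le; first by rewrite addr_ge0 ?opnorm_ge0.
by move=> x; rewrite (le_trans (ler_normD _ _))// mulrDl lerD ?le_opnorm.
Qed.

Fact opnormZ_le (a : R) f : opnorm (a *: f) <= `|a| * opnorm f.
Proof.
apply: opnorm_le; first by rewrite mulr_ge0 ?opnorm_ge0.
by move=> x; rewrite normrZ -mulrA ler_wpM2l ?le_opnorm.
Qed.

Fact opnormZ (a : R) f : opnorm (a *: f) = `|a| * opnorm f.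
Proof.
apply/eqP; rewrite eq_le opnormZ_le/=.
have [->|a0] := eqVneq a 0; first by rewrite normr0 mul0r opnorm_ge0.
rewrite -ler_pdivlMl ?normr_gt0// -normfV.
by rewrite -{1}(scale1r f) -(mulVf a0) -scalerA opnormZ_le.
Qed.

Fact opnorm0_eq0 f : opnorm f = 0 -> f = 0.
Proof.
move=> f0; apply: blinP => x; apply/eqP; rewrite -normr_le0.
by rewrite (le_trans (le_opnorm f x))// f0 mul0r.
Qed.

HB.instance Definition _ :=
  Lmodule_isNormed.Build R L opnormD opnormZ opnorm0_eq0.

End structure.

Fact blin_id_linear (V : normedModType R) : linear (@id V).
Proof. by []. Qed.
Fact blin_id_bounded (V : normedModType R) :
  exists M : R, forall x : V, `|id x| <= M * `|x|.
Proof. by exists 1 => x; rewrite mul1r. Qed.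
Definition blin_id (V : normedModType R) : blin V V :=
  Blin (@blin_id_linear V) (blin_id_bounded V).

Section composition.
Context {V W Z : normedModType R} (g : blin W Z) (f : blin V W).
Fact blin_comp_linear : linear (g \o f).
Proof. by move=> a x y /=; rewrite !linearP. Qed.
Fact blin_comp_bounded : exists M : R, forall x, `|(g \o f) x| <= M * `|x|.
Proof.
have [[M M0 hM] [N _ hN]] := (blin_boundE g, blin_boundE f).
exists (M * N) => x /=.
by rewrite (le_trans (hM _))// -mulrA ler_wpM2l.
Qed.
Definition blin_comp : blin V Z := Blin blin_comp_linear blin_comp_bounded.
End composition.

Definition blin_pow (V : normedModType R) (T : blin V V) (n : nat) : blin V V :=
  iter n (blin_comp T) (blin_id V).

Definition dual (V : normedModType R) := blin V R^o.

Section adjoint.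
Context {V W : normedModType R} (T : blin V W).
Fact adjoint_linear : linear (fun f : dual W => blin_comp f T : dual V).
Proof. by move=> a f g; apply: blinP. Qed.
Fact adjoint_bounded :
  exists M : R, forall f : dual W, `|blin_comp f T : dual V| <= M * `|f|.
Proof.
exists (opnorm T) => f; apply: opnorm_le.
  by rewrite mulr_ge0 ?opnorm_ge0.
move=> x /=; rewrite (le_trans (le_opnorm f _))//.
by rewrite mulrAC mulrC -[X in _ <= X]mulrC mulrC ler_wpM2l ?opnorm_ge0// le_opnorm.
Qed.
Definition adjoint : blin (dual W) (dual V) := Blin adjoint_linear adjoint_bounded.
End adjoint.

(* The weakest topology for which all the maps T |-> (x, T y) are continuous. *)
Definition wstar_eval (V : normedModType R) (T : blin (dual V) (dual V)) :
  {ptws V * dual V -> R} := fun xy => T xy.2 xy.1.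
Definition WstarO (V : normedModType R) := initial_topology (@wstar_eval V).

End bounded_operators.

Section continuous_functions.
Context {R : realType} {Omega : topologicalType}.

(* C(Omega) with the sup norm; compactness, on which finiteness of the norm
   rests, is an argument of the type. *)
Definition contfun (cO : compact [set: Omega]) := continuousType Omega R.

Context {cO : compact [set: Omega]}.
Local Notation X := (contfun cO).
Implicit Types x y : X.

Lemma contfunP x y : x =1 y -> x = y.
Proof. by move=> xy; apply/continuousEP. Qed.

HB.instance Definition _ := Choice.on X.

Definition contfun0 : X := cst 0.
Fact contfunD_cts x y : continuous (fun w => x w + y w).
Proof.
move=> w; have [cx cy] := (@cts_fun _ _ x w, @cts_fun _ _ y w).
exact: (@cvgD _ R^o _ _ _ x y _ _ cx cy).
Qed.
Definition contfunD x y : X := mkcts (@contfunD_cts x y).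
Fact contfunZ_cts (a : R) x : continuous (fun w => a * x w).
Proof.
move=> w; have cx := @cts_fun _ _ x w.
by apply: cvgMl_tmp; exact: cx.
Qed.
Definition contfunZ (a : R) x : X := mkcts (@contfunZ_cts a x).
Definition contfunN x : X := contfunZ (-1) x.

Fact contfunDA : associative contfunD.
Proof. by move=> x y z; apply: contfunP => w; exact: addrA. Qed.
Fact contfunDC : commutative contfunD.
Proof. by move=> x y; apply: contfunP => w; exact: addrC. Qed.
Fact contfun0D : left_id contfun0 contfunD.
Proof. by move=> x; apply: contfunP => w; exact: add0r. Qed.
Fact contfunND : left_inverse contfun0 contfunN contfunD.
Proof.
by move=> x; apply: contfunP => w; rewrite /= /mkcts/= /mkcts mulN1r addNr.
Qed.

HB.instance Definition _ :=
  GRing.isZmodule.Build X contfunDA contfunDC contfun0D contfunND.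

Fact contfunZA a b x : contfunZ a (contfunZ b x) = contfunZ (a * b) x.
Proof. by apply: contfunP => w; exact: mulrA. Qed.
Fact contfunZ1 : left_id 1 contfunZ.
Proof. by move=> x; apply: contfunP => w; exact: mul1r. Qed.
Fact contfunZDr : right_distributive contfunZ +%R.
Proof. by move=> a x y; apply: contfunP => w; exact: mulrDr. Qed.
Fact contfunZDl x : {morph contfunZ^~ x : a b / a + b}.
Proof. by move=> a b; apply: contfunP => w; exact: mulrDl. Qed.

HB.instance Definition _ :=
  GRing.Zmodule_isLmodule.Build R X contfunZA contfunZ1 contfunZDr contfunZDl.

Lemma contfunDE x y w : (x + y) w = x w + y w. Proof. by []. Qed.
Lemma contfunZE (a : R) x w : (a *: x) w = a * x w. Proof. by []. Qed.

Definition supnorm x : R := sup (range (fun w => `|x w|)).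

Lemma supnorm_ub x w : `|x w| <= supnorm x.
Proof.
apply: ub_le_sup; last by exists w.
have : bounded_set (range x : set R^o).
  apply: compact_bounded; apply: continuous_compact => //.
  by apply: continuous_subspaceT; exact: (@cts_fun _ _ x).
case=> M [_ hM]; exists (M + 1) => _ [v _ <-].
by apply: (hM (M + 1)); [rewrite ltrDl|exists v].
Qed.

Lemma supnorm_le x (M : R) :
  0 <= M -> (forall w, `|x w| <= M) -> supnorm x <= M.
Proof.
move=> M0 hM; rewrite /supnorm.
have [->|/set0P A0] := eqVneq (range (fun w => `|x w|)) set0.
  by rewrite sup0.
by apply: ge_sup => // _ [w _ <-].
Qed.

Lemma supnorm_ge0 x : 0 <= supnorm x.
Proof.
rewrite /supnorm.
have [->|/set0P [_ [w _ _]]] := eqVneq (range (fun w => `|x w|)) set0.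
  by rewrite sup0.
by rewrite (le_trans _ (supnorm_ub x w)).
Qed.

Fact supnormD x y : supnorm (x + y) <= supnorm x + supnorm y.
Proof.
apply: supnorm_le => [|w]; first by rewrite addr_ge0 ?supnorm_ge0.
by rewrite contfunDE (le_trans (ler_normD _ _))// lerD ?supnorm_ub.
Qed.

Fact supnormZ_le (a : R) x : supnorm (a *: x) <= `|a| * supnorm x.
Proof.
apply: supnorm_le => [|w]; first by rewrite mulr_ge0 ?supnorm_ge0.
by rewrite contfunZE normrM ler_wpM2l ?supnorm_ub.
Qed.

Fact supnormZ (a : R) x : supnorm (a *: x) = `|a| * supnorm x.
Proof.
apply/eqP; rewrite eq_le supnormZ_le/=.
have [->|a0] := eqVneq a 0; first by rewrite normr0 mul0r supnorm_ge0.
rewrite -ler_pdivlMl ?normr_gt0// -normfV.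
by rewrite -{1}(scale1r x) -(mulVf a0) -scalerA supnormZ_le.
Qed.

Fact supnorm0_eq0 x : supnorm x = 0 -> x = 0.
Proof.
move=> x0; apply: contfunP => w; apply/eqP.
by rewrite -normr_le0 (le_trans (supnorm_ub x w))// x0.
Qed.

HB.instance Definition _ :=
  Lmodule_isNormed.Build R X supnormD supnormZ supnorm0_eq0.

End continuous_functions.
Arguments contfun R {Omega} cO.

Section charge_integral.
Context d (T : measurableType d) (R : realType).
Implicit Type nu : {charge set T -> \bar R}.

Definition hahn_pos nu : set T := projT1 (cid (Hahn_decomposition nu)).
Definition hahn_neg nu : set T :=
  projT1 (cid (projT2 (cid (Hahn_decomposition nu)))).

Lemma hahnP nu : hahn_decomposition nu (hahn_pos nu) (hahn_neg nu).
Proof. exact: projT2 (cid (projT2 (cid (Hahn_decomposition nu)))). Qed.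

Definition cintegral nu (x : T -> R) : R :=
  \int[jordan_pos (hahnP nu)]_w x w - \int[jordan_neg (hahnP nu)]_w x w.

Lemma cintegral_measure (mu : {finite_measure set T -> \bar R}) (x : T -> R) :
  cintegral (charge_of_finite_measure mu) x = \int[mu]_w x w.
Proof.
rewrite /cintegral; set h := hahnP _.
have [[mP posP] [mN negN] PNT PN0] := h.
have muN E : measurable E -> mu (E `&` hahn_neg (charge_of_finite_measure mu)) = 0%E.
  move=> mE; apply/eqP; rewrite eq_le measure_ge0 andbT.
  by apply: negN; [exact: measurableI|exact: subIsetr].
have posE E : measurable E -> jordan_pos h E = mu E.
  move=> mE; rewrite jordan_posE cjordan_posE /crestr0 mem_set// /crestr/=.
  rewrite [RHS](charge_partition (charge_of_finite_measure mu) mE mP mN)//.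
  by rewrite [X in (_ + X)%E]muN// adde0.
have negE E : measurable E -> jordan_neg h E = 0%E.
  move=> mE; rewrite jordan_negE cjordan_negE /crestr0 mem_set// /crestr/=.
  by rewrite [X in (- X)%E]muN// oppe0.
rewrite /Rintegral (eq_measure_integral mu) => [|A mA _]; last exact: posE.
rewrite [X in _ - fine X](eq_measure_integral mzero) => [|A mA _]; last exact: negE.
by rewrite integral_measure_zero/= subr0.
Qed.

End charge_integral.

Section semicascade.
Context {R : realType} {Omega : pointedMetricType R}.
Context (cO : compact [set: Omega]).

Definition borel := g_sigma_algebraType (@open Omega).

Local Notation X := (contfun R cO).

(* The embedding of signed Borel measures in the dual of C(Omega) given by
   integration; by the Riesz theorem it is a bijection. *)
Section measure_functional.
Variable nu : {charge set borel -> \bar R}.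

Fact measurable_contfun (x : X) : measurable_fun [set: borel] (x : borel -> R).
Proof.
apply: (measurability _ (measurable_realfun.RGenOpens.measurableE R)).
move=> _ [_ [a [b ->] <-]]; rewrite setTI; apply: sub_sigma_algebra.
have /continuousP cx : continuous x by exact: (@cts_fun _ _ x).
exact/cx/interval_open.
Qed.

Fact integrable_contfun (mu : {finite_measure set borel -> \bar R}) (x : X) :
  mu.-integrable [set: borel] (EFin \o (x : borel -> R)).
Proof.
apply: measurable_bounded_integrable => //.
- by rewrite ltey_eq fin_num_measure.
- exact: measurable_contfun.
- exists `|x|; split=> [|M xM w _]; first exact: num_real.
  exact: le_trans (supnorm_ub x w) (ltW xM).
Qed.

Fact Rintegral_contfun_linear (mu : {finite_measure set borel -> \bar R}) :
  linear ((fun x : X => \int[mu]_w (x : borel -> R) w) : X -> R^o).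
Proof.
move=> a x y.
transitivity (a * \int[mu]_w (x : borel -> R) w + \int[mu]_w (y : borel -> R) w)%R;
  last by [].
rewrite -RintegralZl//; last exact: integrable_contfun.
rewrite -RintegralD//; last exact: integrable_contfun.
exact: (integrable_contfun mu (a *: x)).
Qed.

Fact Rintegral_contfun_bounded (mu : {finite_measure set borel -> \bar R}) (x : X) :
  `|\int[mu]_w (x : borel -> R) w| <= fine (mu setT) * `|x|.
Proof.
rewrite (le_trans (le_normr_Rintegral _ _))//; first exact: integrable_contfun.
rewrite mulrC -Rintegral_cst//; apply: le_Rintegral => //.
- by have /integrable_abse := integrable_contfun mu x.
- apply: measurable_bounded_integrable => //.
  + by rewrite ltey_eq fin_num_measure.
  + exists `|x|; split=> [|M xM w _]; first exact: num_real.
    by rewrite /= normr_id ltW.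
- by move=> w _; exact: supnorm_ub.
Qed.

Fact cintegral_linear : linear ((fun x : X => cintegral nu x) : X -> R^o).
Proof.
move=> a x y; rewrite /cintegral.
by rewrite !Rintegral_contfun_linear scalerBr opprD addrACA.
Qed.

Fact cintegral_bounded : exists M : R, forall x : X, `|cintegral nu x : R^o| <= M * `|x|.
Proof.
exists (fine (jordan_pos (hahnP nu) setT) + fine (jordan_neg (hahnP nu) setT)).
move=> x; rewrite mulrDl (le_trans (ler_normB _ _))// lerD//.
  exact: Rintegral_contfun_bounded.
exact: Rintegral_contfun_bounded.
Qed.

Definition meas : dual X := Blin cintegral_linear cintegral_bounded.

End measure_functional.

Definition pmeas (mu : probability borel R) : dual X :=
  meas (charge_of_finite_measure mu).

Definition delta (w : Omega) : dual X := pmeas (@dirac _ borel w R).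

Lemma deltaE (w : Omega) (x : X) : delta w x = x w.
Proof.
rewrite /delta/= cintegral_measure /Rintegral integral_dirac//=.
  by rewrite indicT mul1r.
by apply/measurable_realfun.measurable_EFinP; exact: measurable_contfun.
Qed.

Context (phi : continuousType Omega Omega).

Fact iter_cts (n : nat) : continuous (iter n phi).
Proof.
elim: n => [|n ih] w; first exact: cvg_id.
by apply: (@continuous_comp _ _ _ (iter n phi) phi); [exact: ih|exact: cts_fun].
Qed.

Definition translate (x : X) (n : nat) : X := x \o mkcts (@iter_cts n).

Definition tame := forall (x : X) (n : nat -> nat),
  (forall k, (0 < n k)%N) -> {homo n : i j / (i < j)%N} ->
  inf [set `|\sum_(k < size a) a`_k *: translate x (n k)| |
        a in [set a : seq R | \sum_(k < size a) `|a`_k| = 1]] = 0.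

Fact koopman_linear : linear (fun x : X => (x \o phi : X)).
Proof. by move=> a x y; apply: contfunP. Qed.
Fact koopman_bounded :
  exists M : R, forall x : X, `|(x \o phi : X)| <= M * `|x|.
Proof.
by exists 1 => x; rewrite mul1r; apply: supnorm_le => [|w] /=;
  [exact: supnorm_ge0|exact: (supnorm_ub x)].
Qed.

Definition koopman : blin X X := Blin koopman_linear koopman_bounded.
Definition koopman_adj : blin (dual X) (dual X) := adjoint koopman.

Definition Gamma : set (blin (dual X) (dual X)) :=
  @closure (WstarO X) (range (blin_pow koopman_adj)).

Definition ellis : set (Omega -> Omega) :=
  @closure {ptws Omega -> Omega} (range (fun n => iter n phi)).

Lemma blin_pow_V (n : nat) (f : dual X) (x : X) :
  blin_pow koopman_adj n f x = f (translate x n).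
Proof.
elim: n x => [|n ih] x; first by congr (blin_fun f _); exact: contfunP.
transitivity (blin_pow koopman_adj n f (x \o phi : X)); first by [].
by rewrite ih; congr (blin_fun f _); exact: contfunP.
Qed.

Lemma delta_inj : injective delta.
Proof.
move=> a b ab; apply: contrapT => /eqP anb.
have cd : continuous (fun w : Omega => (mdist a w : R)).
  move=> w; apply/(@cvgrPdist_lt _ R^o) => e e0.
  near=> v; have : ball w e v by near: v; exact: nbhsx_ballx.
  rewrite ballEmdist/= => vw; rewrite (le_lt_trans _ vw)// ler_norml.
  have := metric_triangle a w v; have := metric_triangle a v w.
  by rewrite (metric_sym v w); lra.
pose x : X := mkcts cd.
have : delta a x = delta b x by rewrite ab.
rewrite !deltaE => abx; have : mdist a b = 0.
  by rewrite -[LHS]/(x b) -abx; exact: mdistxx.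
by move=> /mdist_positivity/eqP; rewrite (negbTE anb).
Unshelve. all: by end_near. Qed.

Definition pi_spec (P : blin (dual X) (dual X)) (p : Omega -> Omega) :=
  ellis p /\ forall w, P (delta w) = delta (p w).

Lemma pi_spec_uniq P p q : pi_spec P p -> pi_spec P q -> p = q.
Proof.
by move=> [_ Pp] [_ Pq]; apply/funext => w; apply: delta_inj; rewrite -Pp -Pq.
Qed.

Lemma pi_spec_ex P : Gamma P -> exists p, pi_spec P p.
Proof.
move=> GP.
pose G : set_system {ptws Omega -> Omega} := filter_from (nbhs (P : WstarO X))
  (fun A => [set iter n phi | n in [set n | A (blin_pow koopman_adj n)]]).
have FG : ProperFilter G.
  apply: filter_from_proper.
    apply: filter_from_filter; first by exists setT; exact: filterT.
    move=> A B PA PB; exists (A `&` B); first exact: filterI.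
    by move=> _ [n [nA nB] <-]; split; exists n.
  by move=> A /GP [_ [[n _ <-] An]]; exists (iter n phi), n.
have cpt : compact [set: {ptws Omega -> Omega}].
  have := @tychonoff Omega (fun=> Omega) (fun=> setT) (fun=> cO).
  by congr compact; apply/seteqP; split.
have [p [_ clp]] := cpt G FG filterT.
exists p; split.
  move=> B /(clp (range (fun n => iter n phi)) B); apply.
  by exists setT; [exact: filterT|move=> _ [n _ <-]; exists n].
move=> w; apply: blinP => x; rewrite deltaE.
apply: contrapT => /eqP; rewrite -subr_eq0 -normr_gt0.
set e := `|_| => e0.
have e20 : 0 < e / 2 by rewrite divr_gt0.
pose A : set (WstarO X) := [set T |
  `|P (delta w) x - (T : blin (dual X) (dual X)) (delta w) x| < e / 2].
have nA : nbhs (P : WstarO X) A.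
  have c1 : continuous (@wstar_eval R X : WstarO X -> _).
    exact: initial_continuous.
  have c2 : continuous (fun g : {ptws X * dual X -> R} => g (x, delta w)).
    exact: proj_continuous.
  have c : wstar_eval T (x, delta w) @[T --> (P : WstarO X)] -->
      (P (delta w) x : R^o) by exact: continuous_comp (c1 P) (c2 _).
  by have /cvgrPdist_lt/(_ _ e20) := c.
pose B : set {ptws Omega -> Omega} :=
  (fun q => x (q w)) @^-1` ball (x (p w) : R^o) (e / 2).
have nB : nbhs (p : {ptws Omega -> Omega}) B.
  have c1 : continuous (fun g : {ptws Omega -> Omega} => g w).
    exact: proj_continuous.
  have c : x (q w) @[q --> (p : {ptws Omega -> Omega})] --> (x (p w) : R^o).
    exact: continuous_comp (c1 p) (@cts_fun _ _ x (p w)).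
  apply: (c (ball (x (p w) : R^o) (e / 2))); exact: nbhsx_ballx.
have [_ [[n An <-]]] := clp _ _ (ex_intro2 _ _ A nA (fun=> id)) nB.
rewrite /B/= -ball_normE/= => Bn; move: An; rewrite /A/= blin_pow_V deltaE => An.
have : e < e / 2 + e / 2.
  rewrite /e (le_lt_trans (ler_distD (x (iter n phi w)) _ _))// ltrD//.
  by rewrite distrC.
by rewrite -splitr ltxx.
Qed.

(* The canonical epimorphism, well-defined by pi_spec_ex and pi_spec_uniq. *)
Definition pi_map (P : blin (dual X) (dual X)) : Omega -> Omega :=
  xget (idfun : {ptws Omega -> Omega}) (pi_spec P).

Definition regular (P : blin (dual X) (dual X)) :=
  measurable_fun [set: borel] (pi_map P : borel -> borel) /\
  forall mu : probability borel R, exists nu : {charge set borel -> \bar R},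
    P (pmeas mu) = meas nu /\
    forall e : set borel, measurable e -> nu e = mu (pi_map P @^-1` e).

End semicascade.

(* Main.v *)
Require Import Defs.
From HB Require Import structures.
From mathcomp Require Import all_boot all_order all_algebra.
From mathcomp Require Import all_classical all_reals all_analysis.
From mathcomp Require Import lra.

(* Fix [x] and put [f_n = x \o phi^n] and [f = x \o p]. If, on some nonempty set
   [K], every finite family of open sets meeting [K] admits one [f_n] taking
   values below [a] and above [b > a] on the trace on [K] of each of its members,
   then a subsequence of [f_n] is independent for [(a, b)], hence is equivalent to
   the unit basis of l1: tameness forbids this. Since [f] is a pointwise limit of
   [f_n] along a net, it follows first that no nonempty [K] contains both
   [f < a] and [f > b] densely, which makes [f] Borel, and then, the integrals of
   [f_n] over finitely many Borel sets being controlled along the same net, that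
   [P mu x] cannot differ from the integral of [f]: the difference would be
   concentrated on a set where [f < a] while [f_n] has average above [b] on each
   nonempty relatively open subset. *)

Set Implicit Arguments.
Unset Strict Implicit.
Unset Printing Implicit Defensive.

Import Order.TTheory GRing.Theory Num.Theory.
Import numFieldTopology.Exports numFieldNormedType.Exports.

Local Open Scope classical_set_scope.
Local Open Scope ring_scope.

(** * Independent subsequences of an alternating sequence of functions *)

Section independence.
Context {R : realType} {T : topologicalType}.
Implicit Types (g : nat -> T -> R) (K U : set T) (Us : seq (set T)).

Definition side (h : T -> R) (a b : R) (s : bool) : set T :=
  if s then [set w | b < h w] else [set w | h w < a].

Lemma open_side (h : T -> R) a b s : continuous h -> open (side h a b s).
Proof.
move=> /continuousP ch; case: s.
- by have := ch _ (@open_gt _ b).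
- by have := ch _ (@open_lt _ a).
Qed.

(** Rosenthal's independence in finite form: only initial segments of a sign pattern are realized,
    which matches the finitely supported combinations in [tame]. *)
Definition independent g (a b : R) (n : nat -> nat) :=
  forall k (s : nat -> bool), exists w,
    forall i, (i < k)%N -> side (g (n i)) a b (s i) w.

Definition meets_openly K Us :=
  forall U, U \in Us -> open U /\ U `&` K !=set0.

(** The index [n] comes after the family and serves all its members, so that one function splits
    each of them in two. *)
Definition alternating g K (a b : R) := forall Us, meets_openly K Us ->
  exists n, forall U s, U \in Us -> U `&` side (g n) a b s `&` K !=set0.

(* On open sets where each of [g 0 .. g N] oscillates by less than [b - a],
   the index provided by the hypothesis exceeds [N]. *)
Lemma alternating_gt g K (a b : R) (N : nat) Us : a < b ->
  (forall n, continuous (g n)) -> K !=set0 -> alternating g K a b ->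
  meets_openly K Us ->
  exists2 n, (N < n)%N &
    forall U s, U \in Us -> U `&` side (g n) a b s `&` K !=set0.
Proof.
move=> ab cg [k0 Kk0] alt mUs.
have e0 : 0 < (b - a) / 2 by rewrite divr_gt0// subr_gt0.
pose near_pt w := [set v | forall m : 'I_N.+1, `|g m w - g m v| < (b - a) / 2].
have near_open w : nbhs w (near_pt w).
  apply: filter_forall => m.
  by have /(@cvgrPdist_lt _ R^o)/(_ _ e0) := cg m w.
have /choice[c cP] : forall U, exists w, U \in Us -> (U `&` K) w.
  move=> U; have [/mUs[_ [w Uw]]|UUs] := boolP (U \in Us); first by exists w.
  by exists k0.
pose V U := U `&` (near_pt (c U))°.
pose V0 := (near_pt k0)°.
(* The contradiction for [n <= N] is drawn on [V0], which is in the list even when [Us] is empty. *)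
have [|n nP] := alt (V0 :: map V Us).
  move=> U; rewrite inE => /orP[/eqP ->|/mapP[U' U'Us ->]].
    split; first exact: open_interior.
    by exists k0; split=> //; exact: near_open.
  have [oU' _] := mUs _ U'Us; have [U'c Kc] := cP _ U'Us.
  split; first by apply: openI => //; exact: open_interior.
  by exists (c U'); split => //; split=> //; exact: near_open.
exists n => [|U s UUs]; last first.
  have [|w [[[Uw _] sw] Kw]] := nP (V U) s; last by exists w.
  by rewrite inE map_f ?orbT.
rewrite ltnNge -ltnS; apply/negP => nN.
have V0in : V0 \in V0 :: map V Us by rewrite inE eqxx.
have [u [[/interior_subset/(_ (Ordinal nN))/= u1 u2] _]] := nP _ true V0in.
have [v [[/interior_subset/(_ (Ordinal nN))/= v1 v2] _]] := nP _ false V0in.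
move: u1 u2 v1 v2; rewrite /= !ltr_norml; lra.
Qed.

(** Build a binary tree of open sets meeting [K], in which one function per level splits every node
    into its two sides. A sign pattern is a branch, and any point of its last node realizes it. *)
Lemma independent_subsequence g K (a b : R) : a < b ->
  (forall n, continuous (g n)) -> K !=set0 -> alternating g K a b ->
  exists n : nat -> nat, [/\ forall k, (0 < n k)%N,
    {homo n : i j / (i < j)%N} & independent g a b n].
Proof.
move=> ab cg K0 alt.
pose next Us n := [seq U `&` side (g n) a b true | U <- Us] ++
  [seq U `&` side (g n) a b false | U <- Us].
have /choice[F FP] : forall p : seq (set T) * nat, exists n,
    meets_openly K p.1 -> (p.2 < n)%N /\ meets_openly K (next p.1 n).
  move=> [Us N] /=; have [mUs|] := pselect (meets_openly K Us); last by exists 0%N.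
  have [n Nn nP] := alternating_gt N ab cg K0 alt mUs.
  exists n => _; split=> // U; rewrite mem_cat => /orP[]/mapP[V VUs ->]; split.
  - by apply: openI; [case: (mUs _ VUs)|exact: open_side].
  - exact: nP.
  - by apply: openI; [case: (mUs _ VUs)|exact: open_side].
  - exact: nP.
(* [st k] holds the nodes of level [k] and the index that produced them. The index 0 at the root is
   a dummy: the subsequence starts at [st 1], hence is positive. *)
pose st := fix st k := if k is k'.+1 then
  let n := F (st k') in (next (st k').1 n, n) else ([:: setT], 0%N).
have mst k : meets_openly K (st k).1.
  elim: k => [|k ih] /=; last by have [] := FP _ ih.
  move=> U; rewrite inE => /eqP ->; split; first exact: openT.
  by rewrite setTI.
have st_lt k : ((st k).2 < (st k.+1).2)%N by have [] := FP _ (mst k).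
exists (fun k => (st k.+1).2); split.
- by move=> k; exact: leq_ltn_trans (st_lt k).
- exact: (homo_ltn ltn_trans).
- move=> k s.
  suff [U Uin UP] : exists2 U, U \in (st k).1 & forall w, U w ->
      forall i, (i < k)%N -> side (g (st i.+1).2) a b (s i) w.
    by have [_ [w [Uw _]]] := mst k _ Uin; exists w => i; exact: UP.
  elim: k => [|k [U Uin UP]]; first by exists setT => //; rewrite inE.
  exists (U `&` side (g (st k.+1).2) a b (s k)).
    rewrite /= mem_cat; apply/orP.
    by case: (s k); [left|right]; apply/mapP; exists U.
  move=> w [Uw sw] i; rewrite ltnS leq_eqVlt => /orP[/eqP ->//|ik].
  exact: UP.
Qed.

End independence.

(** * Tameness against alternation, and approximation of [P] by powers *)

Section tame_semicascade.
Context {R : realType} {Omega : pointedMetricType R}.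
Context (cO : compact [set: Omega]) (phi : continuousType Omega Omega).
Local Notation X := (contfun R cO).
Implicit Types (x : X) (P : blin (dual X) (dual X)).

(* Choosing the signs of an independent sequence after those of the coefficients
   gives two values of the linear combination at distance at least [b - a], so
   independence bounds the l1-norm by a multiple of the sup norm. *)
Lemma tame_not_independent x (a b : R) (n : nat -> nat) : tame cO phi -> a < b ->
  (forall k, (0 < n k)%N) -> {homo n : i j / (i < j)%N} ->
  ~ independent (translate phi x : nat -> Omega -> R) a b n.
Proof.
move=> tm ab n0 nlt ind.
set S := [set `|\sum_(k < size c) c`_k *: translate phi x (n k)| |
        c in [set c : seq R | \sum_(k < size c) `|c`_k| = 1]].
have S0 : S !=set0.
  eexists; exists [:: 1] => //.
  by rewrite /= big_ord_recl big_ord0 /= normr1 addr0.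
have e0 : 0 < (b - a) / 2 by rewrite divr_gt0// subr_gt0.
have infS : has_inf S by split=> //; exists 0 => _ [c _ <-].
have [_ [c c1 <-]] := inf_adherent e0 infS.
rewrite (tm _ _ n0 nlt) add0r; apply/negP; rewrite -leNgt.
set y := \sum_(k < _) _.
have yE w : y w = \sum_(k < size c) c`_k * translate phi x (n k) w.
  rewrite /y; elim/big_ind2 : _ => //.
  by move=> y1 s1 y2 s2 e1 e2; rewrite contfunDE e1 e2.
have [u uP] := ind (size c) (fun k => 0 < c`_k).
have [v vP] := ind (size c) (fun k => ~~ (0 < c`_k)).
(* Here [t] is a coefficient and [p], [q] are the values at [u], [v] of the function it
   multiplies. *)
have combine (p q t : R) : (0 < t -> q < a /\ b < p) ->
    (t <= 0 -> b < q /\ p < a) -> (b - a) * `|t| <= t * p - t * q.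
  rewrite -mulrBr; case: (ltP 0 t) => [t0 /(_ isT)[qa bp] _|t0 _ /(_ isT)[bq pa]].
    by rewrite gtr0_norm//; nra.
  by rewrite ler0_norm//; nra.
have : b - a <= y u - y v.
  rewrite -[b - a]mulr1 -c1 !yE mulr_sumr -sumrB; apply: ler_sum => k _.
  have := uP _ (ltn_ord k); have := vP _ (ltn_ord k); rewrite /side.
  by case: ltP => t0 /= hq hp; apply: combine => // t0';
    [have := lt_le_trans t0 t0'|have := lt_le_trans t0' t0]; rewrite ltxx.
move=> h; have := supnorm_ub y u; have := supnorm_ub y v.
suff : `|y v| <= supnorm y -> `|y u| <= supnorm y -> (b - a) / 2 <= supnorm y.
  by move=> hs hv hu; exact: hs.
rewrite !ler_norml; lra.
Qed.

Lemma tame_not_alternating x (K : set Omega) (a b : R) : tame cO phi -> a < b ->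
  K !=set0 -> ~ alternating (translate phi x : nat -> Omega -> R) K a b.
Proof.
move=> tm ab K0 alt.
have ct n : continuous (translate phi x n : Omega -> R).
  exact: (@cts_fun _ _ (translate phi x n)).
have [n [n0 nlt ind]] := independent_subsequence ab ct K0 alt.
exact: tame_not_independent tm ab n0 nlt ind.
Qed.

(** Finitely many strict inequalities define a neighbourhood of [P], which must contain a power.
    Upper bounds are covered as lower bounds for opposite functionals. *)
Lemma Gamma_approx P x (l : seq (dual X * R)) : Gamma phi P ->
  (forall q, q \in l -> q.2 < P q.1 x) ->
  exists n, forall q, q \in l -> q.2 < q.1 (translate phi x n).
Proof.
move=> GP lP.
have nb : nbhs (P : WstarO X) (fun T =>
    forall q, q \in l -> q.2 < (T : blin (dual X) (dual X)) q.1 x).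
  elim: l lP => [|q l ih] lP; first exact: filterE.
  have nl := ih (fun q' h => lP q' (mem_behead (s := q :: l) h)).
  have nq : nbhs (P : WstarO X) (fun T => q.2 < (T : blin (dual X) (dual X)) q.1 x).
    have c1 : continuous (@wstar_eval R X : WstarO X -> _).
      exact: initial_continuous.
    have c2 : continuous (fun g : {ptws X * dual X -> R} => g (x, q.1)).
      exact: proj_continuous.
    have c : wstar_eval T (x, q.1) @[T --> (P : WstarO X)] -->
        (P q.1 x : R^o) by exact: continuous_comp (c1 P) (c2 _).
    apply: (c [set r | q.2 < r]); apply: open_nbhs_nbhs; split.
      exact: open_gt.
    by apply: lP; rewrite mem_head.
  near=> T => q'; rewrite inE => /orP[/eqP ->|].
    by near: T.
  by move: q'; near: T.
have [_ [[n _ <-] nP]] := GP _ nb.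
by exists n => q ql; rewrite -(blin_pow_V _ n); exact: nP.
Unshelve. all: by end_near. Qed.

End tame_semicascade.

(** * Fragmented functions and Borel measurability *)

Lemma second_countable_union (T : topologicalType) (Q : set (set T)) :
  @second_countable T -> (forall U V, U `<=` V -> Q V -> Q U) -> Q set0 ->
  exists V : nat -> set T, (forall i, open (V i) /\ Q (V i)) /\
    forall U, open U -> Q U -> U `<=` \bigcup_i V i.
Proof.
move=> [B /countable_injP[f finj] [Bo Bb]] Qsub Q0.
(* [V i] is the basic open set of code [i] if it exists and satisfies [Q], and [set0] otherwise. *)
have /choice[V VP] : forall i, exists V, [/\ open V, Q V &
    forall U, B U -> Q U -> f U = i -> V = U].
  move=> i; have [[U [BU QU fU]]|nU] :=
      pselect (exists U, [/\ B U, Q U & f U = i]).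
    exists U; split=> // [|U' BU' QU' fU']; first exact: Bo.
    by apply: finj; rewrite ?inE// fU.
  exists set0; split=> // [|U BU QU fU]; first exact: open0.
  by exfalso; apply: nU; exists U.
exists V; split=> [i|U oU QU w Uw]; first by have [] := VP i.
have [|W [BW Ww] WU] := Bb w U; first exact: open_nbhs_nbhs.
exists (f W) => //; have [_ _ /(_ W BW _ erefl) ->//] := VP (f W).
exact: Qsub QU.
Qed.

Section borel_functions.
Context {R : realType} {Omega : pointedMetricType R}.
Local Notation borel := (@borel R Omega).
Implicit Types (f : Omega -> R) (K U : set Omega).

Lemma open_borel U : open U -> measurable (U : set borel).
Proof. by move=> oU; apply: sub_sigma_algebra. Qed.

(** A two-level form of the notion of fragmented map: instead of having small oscillation on [U]
    within [K], [f] misses one of its two sides there. *)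
Definition fragmented f (a b : R) := forall K, K !=set0 ->
  exists U s, [/\ open U, U `&` K !=set0 & U `&` side f a b s `&` K = set0].

(* [W] below is the largest open set on which [f < a] and [f > b] can be
   separated; fragmentation of its complement shows that it is everything. *)
Lemma fragmented_separated f a b : @second_countable Omega ->
  fragmented f a b ->
  exists S : set borel, [/\ measurable S, forall w, f w < a -> S w &
    forall w, S w -> f w <= b].
Proof.
move=> sc frag.
pose sep U := exists S : set borel, [/\ measurable S,
  forall w, U w -> f w < a -> S w & forall w, U w -> S w -> f w <= b].
have [||V [VP Vmax]] := @second_countable_union Omega sep sc.
- by move=> U V UV [S [mS Sa Sb]]; exists S; split=> // w /UV; [exact: Sa|exact: Sb].
- by exists set0; split.
pose W := \bigcup_i V i.
have oW : open W by apply: bigcup_open => i _; case: (VP i).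
have [S [mS Sa Sb]] : exists S : set borel, [/\ measurable S,
  forall w, W w -> f w < a -> S w & forall w, S w -> W w /\ f w <= b].
  have /choice[S SP] := fun i => (VP i).2.
  exists (\bigcup_i (S i `&` V i)); split.
  - apply: bigcup_measurable => i _; apply: measurableI.
      by case: (SP i).
    by apply: open_borel; case: (VP i).
  - by move=> w [i _ Viw] fw; exists i => //; split=> //; case: (SP i) => _ + _; exact.
  - move=> w [i _ [Siw Viw]]; split; first by exists i.
    by have [_ _] := SP i; exact.
suff WT : forall w, W w.
  by exists S; split=> [//|w|w /Sb[]//]; exact: Sa.
move=> w; apply: contrapT => Ww.
have [|U [s [oU [v [Uv Wv]] UW0]]] := frag (~` W); first by exists w.
apply: Wv; apply: (Vmax U) => //.
(* In both cases [U] is separated, hence inside [W], although [v] is not. If [f > b] is missed off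
   [W], all points off [W] can be added to [S]; if [f < a] is missed, [S] already works. *)
case: s UW0 => UW0.
- exists (S `|` ~` W); split.
  + by apply: measurableU => //; apply: measurableC; exact: open_borel.
  + by move=> u Uu fu; have [Wu|Wu] := pselect (W u); [left; exact: Sa|right].
  + move=> u Uu [/Sb[]//|Wu]; rewrite leNgt; apply/negP => fu.
    by have : set0 u by rewrite -UW0.
- exists S; split=> [//|u Uu fu|u _ /Sb[]//].
  apply: Sa => //; apply: contrapT => Wu.
  by have : set0 u by rewrite -UW0.
Qed.

Lemma fragmented_measurable f : @second_countable Omega ->
  (forall a b, a < b -> fragmented f a b) ->
  measurable_fun [set: borel] (f : borel -> R).
Proof.
move=> sc frag.
apply: (measurability _ (measurable_realfun.RGenInftyO.measurableE R)).
move=> _ [_ [c ->] <-]; rewrite setTI.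
(* Separating at two levels that both increase to [c] and stay below it makes the union of the [S n]
   equal to the set where [f < c]. *)
have /choice[S SP] : forall n, exists S : set borel, [/\ measurable S,
    forall w, f w < c - n.+1%:R^-1 -> S w &
    forall w, S w -> f w <= c - n.+2%:R^-1].
  move=> n; apply: fragmented_separated => //; apply: frag.
  by rewrite ltrD2l ltrN2 ltf_pV2 ?posrE// ltr_nat.
suff -> : f @^-1` `]-oo, c[%classic = \bigcup_n S n.
  by apply: bigcup_measurable => n _; case: (SP n).
apply/seteqP; split=> [w|w [n _ Snw]] /=; rewrite in_itv/=.
  move=> fc; have /ltr_add_invr[n hn] := fc.
  by exists n => //; case: (SP n) => _ + _; apply; rewrite ltrBrDr.
have [_ _ /(_ w Snw) h] := SP n; apply: (le_lt_trans h).
by rewrite ltrBlDr ltrDl invr_gt0.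
Qed.

Definition dist_from (cO : compact [set: Omega]) (a : Omega) : contfun R cO.
Proof.
apply: (@mkcts _ _ (fun w => mdist a w : R)) => w.
apply/(@cvgrPdist_lt _ R^o) => e e0; near=> v.
have : ball w e v by near: v; exact: nbhsx_ballx.
rewrite ballEmdist/= => vw; rewrite (le_lt_trans _ vw)// ler_norml.
have := metric_triangle a w v; have := metric_triangle a v w.
by rewrite (metric_sym v w); lra.
Unshelve. all: by end_near. Defined.

(** An open set is a countable union of balls, and the preimage of a ball is a sublevel set of
    [x \o p] with [x] the distance to its centre. *)
Lemma measurable_to_borel (cO : compact [set: Omega]) (p : Omega -> Omega) :
  (forall x : contfun R cO, measurable_fun [set: borel] (x \o p : borel -> R)) ->
  measurable_fun [set: borel] (p : borel -> borel).
Proof.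
move=> mp; apply: (@measurability _ _ borel borel setT p (@open Omega)) => //.
move=> _ [G oG <-]; rewrite setTI.
pose inO U := exists q : Omega * R,
  U `<=` [set v | mdist q.1 v < q.2] /\ [set v | mdist q.1 v < q.2] `<=` G.
have sc : @second_countable Omega by exact: compact_second_countable.
have [||V [VP Vmax]] := @second_countable_union Omega inO sc.
- by move=> U V UV [q [Vq qG]]; exists q; split=> //; exact: subset_trans Vq.
- by exists (point, 0); split=> // v /=; rewrite ltNge mdist_ge0.
have /choice[q qP] := fun i => (VP i).2.
suff -> : p @^-1` G =
    \bigcup_i ((dist_from cO (q i).1 \o p) @^-1` `]-oo, (q i).2[%classic).
  apply: bigcup_measurable => i _.
  by rewrite -[X in measurable X]setTI; apply: mp => //; exact: measurable_itv.
apply/seteqP; split=> [w Gpw|w [i _]] /=; last first.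
  by rewrite in_itv/= => h; apply: (qP i).2.
have /nbhs_ballP[e /= e0 eG] : nbhs (p w) G by exact: open_nbhs_nbhs.
have [|||i _ Vi] := Vmax (ball (p w) e)° _ _ (p w).
- exact: open_interior.
- exists (p w, e); rewrite -[X in X `<=` G]ballEmdist; split=> //.
  by rewrite -[X in _ `<=` X]ballEmdist; exact: interior_subset.
- exact: nbhsx_ballx.
by exists i => //; rewrite /= in_itv/=; exact: (qP i).1.
Qed.

End borel_functions.

(** * The map [pi_map phi P] is Borel *)

Section tame_borel.
Context {R : realType} {Omega : pointedMetricType R}.
Context (cO : compact [set: Omega]) (phi : continuousType Omega Omega).
Local Notation X := (contfun R cO).
Variable P : blin (dual X) (dual X).
Hypotheses (tm : tame cO phi) (GP : Gamma phi P).
Local Notation p := (pi_map phi P).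

Lemma pi_mapP (w : Omega) (x : X) : P (delta cO w) x = x (p w).
Proof.
have [_ Pd] : Defs.pi_spec phi P p by exact: xgetPex (pi_spec_ex GP).
by rewrite Pd deltaE.
Qed.

(** Otherwise each open set of a finite family has points of [K] on both sides of [x \o p].
    Approximating [P] at the Dirac measures of these points gives one [n] for which
    [translate phi x n] lies on the same sides, so the translates alternate. *)
Lemma fragmented_pi_map (x : X) a b : a < b -> fragmented (x \o p) a b.
Proof.
move=> ab K K0; apply: contrapT => nfrag.
apply: (tame_not_alternating (x := x) tm ab K0) => Us mUs.
have /choice[c cP] : forall Us' : set Omega * bool, exists w,
    Us'.1 \in Us -> (Us'.1 `&` side (x \o p) a b Us'.2 `&` K) w.
  move=> [U s] /=; have [UUs|UUs] := boolP (U \in Us); last by exists point.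
  have [oU UK] := mUs _ UUs.
  apply: contrapT => nw; apply: nfrag; exists U, s; split=> //.
  by apply/seteqP; split=> // w Hw; exfalso; apply: nw; exists w.
pose l := [seq (delta cO (c (U, true)), b) | U <- Us] ++
          [seq (- delta cO (c (U, false)), - a) | U <- Us].
have [|n nP] := Gamma_approx (x := x) (l := l) GP.
  move=> q; rewrite mem_cat => /orP[]/mapP[U UUs ->] /=.
  - by rewrite pi_mapP; have [[_ +] _] := cP (U, true) UUs.
  - rewrite linearN/= -[X in _ < X]/(-1 * _) mulN1r ltrN2 pi_mapP.
    by have [[_ +] _] := cP (U, false) UUs.
exists n => U s UUs; have [[Uc _] Kc] := cP (U, s) UUs.
exists (c (U, s)); split=> //; split=> //.
case: s {Uc Kc} => /=.
- have : b < delta cO (c (U, true)) (translate phi x n).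
    by apply: (nP (_, _)); rewrite mem_cat map_f.
  by rewrite deltaE.
- have : - a < (- delta cO (c (U, false)) : dual X) (translate phi x n).
    by apply: (nP (_, _)); rewrite mem_cat; apply/orP; right; apply/mapP; exists U.
  by rewrite -[X in _ < X]/(-1 * _) mulN1r ltrN2 deltaE.
Qed.

Lemma measurable_contfun_pi (x : X) :
  measurable_fun [set: @borel R Omega] (x \o p : @borel R Omega -> R).
Proof.
apply: fragmented_measurable; first exact: compact_second_countable.
by move=> a b ab; exact: fragmented_pi_map.
Qed.

Lemma measurable_pi :
  measurable_fun [set: @borel R Omega] (p : @borel R Omega -> @borel R Omega).
Proof. exact: measurable_to_borel measurable_contfun_pi. Qed.

End tame_borel.

(** * Finitely additive set functions dominated by a finite measure *)

Section dominated.
Context d (T : measurableType d) (R : realType).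
Variable mu : {finite_measure set T -> \bar R}.
Implicit Types (k : set T -> R) (A B : set T).

Definition finitely_additive k := forall A B, measurable A -> measurable B ->
  A `&` B = set0 -> k (A `|` B) = k A + k B.

Lemma finitely_additive0 k : finitely_additive k -> k set0 = 0.
Proof.
move=> /(_ set0 set0 measurable0 measurable0 (setI0 _)); rewrite setU0; lra.
Qed.

Lemma finitely_additive_sum k (F : nat -> set T) n : finitely_additive k ->
  (forall i, measurable (F i)) -> trivIset setT F ->
  \sum_(i < n) k (F i) = k (\big[setU/set0]_(i < n) F i).
Proof.
move=> kadd mF tF; elim: n => [|n ih].
  by rewrite !big_ord0 finitely_additive0.
rewrite !big_ord_recr/= ih kadd//; first exact: bigsetU_measurable.
apply/seteqP; split=> // w []; rewrite -bigcup_mkord => -[i /= ilt Fi Fn].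
have := tF i n I I (ex_intro _ w (conj Fi Fn)) => eq_in.
by move: ilt; rewrite eq_in ltnn.
Qed.

Lemma finitely_additive_fine : finitely_additive (fun A => fine (mu A)).
Proof. by move=> A B mA mB AB; rewrite measureU// fineD// fin_num_measure. Qed.

(** The remainder of the series is the value of [k] on a tail of the union, and [mu] of the tails
    tends to 0. *)
Lemma dominated_sigma_additive k (C : R) : finitely_additive k ->
  (forall A, measurable A -> `|k A| <= C * fine (mu A)) ->
  semi_sigma_additive (fun A => (k A)%:E).
Proof.
move=> kadd kmu F mF tF mUF.
have sum_mu : (fun n => \sum_(i < n) fine (mu (F i))) @ \oo -->
    fine (mu (\bigcup_i F i)).
  have := @measure_semi_sigma_additive _ _ _ mu F mF tF mUF.
  rewrite -[X in _ --> X]fineK ?fin_num_measure// => /fine_cvg.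
  apply: cvg_trans; apply: near_eq_cvg; apply: nearW => n /=.
  by rewrite big_mkord -sum_fine// => i _; rewrite fin_num_measure.
suff : (fun n => \sum_(i < n) k (F i)) @ \oo --> (k (\bigcup_i F i) : R^o).
  move=> cvgk.
  rewrite (_ : (fun _ => _) = EFin \o (fun n => \sum_(i < n) k (F i))).
    by apply: cvg_EFin => //; exact: nearW.
  by apply/funext => n /=; rewrite big_mkord sumEFin.
have rest g n : finitely_additive g -> g (\bigcup_i F i) - \sum_(i < n) g (F i) =
    g (\bigcup_i F i `\` \big[setU/set0]_(i < n) F i).
  move=> gadd; rewrite (finitely_additive_sum n gadd mF tF).
  set B := \big[setU/set0]_(i < n) F i.
  have mB : measurable B by exact: bigsetU_measurable.
  have BF : B `<=` \bigcup_i F i.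
    by rewrite /B -bigcup_mkord => w [i _ Fi]; exists i.
  rewrite -{1}(setDUK BF) gadd//; first by lra.
  - exact: measurableD.
  - by apply/seteqP; split=> // w [Bw [_]].
apply/cvgrPdist_le => e e0.
(* A positive divisor, whatever the sign of [C]. *)
have C1 : 0 < `|C| + 1 by rewrite ltr_wpDl.
have /cvgrPdist_le/(_ (e / (`|C| + 1))) := sum_mu.
move=> /(_ (divr_gt0 e0 C1)); apply: filterS => n.
rewrite (rest k n kadd) (rest _ n finitely_additive_fine).
set D := _ `\` _ => muD.
have mD : measurable D by apply: measurableD => //; exact: bigsetU_measurable.
rewrite (le_trans (kmu _ mD))// (le_trans (ler_norm _))// normrM.
rewrite -[e](divfK (lt0r_neq0 C1)) mulrC ler_pM// lerDl//.
Qed.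

(** Domination makes [k] a charge. Its Hahn positive set serves as [E]: discarding the negative set
    cannot decrease the value. *)
Lemma dominated_positive_set k (C : R) : finitely_additive k ->
  (forall A, measurable A -> `|k A| <= C * fine (mu A)) ->
  exists E, [/\ measurable E, k setT <= k E &
    forall A, measurable A -> A `<=` E -> 0 <= k A].
Proof.
move=> kadd kmu.
pose kE A := (k A)%:E.
have kE0 : kE set0 = 0%E by rewrite /kE finitely_additive0.
have kEfin A : measurable A -> kE A \is a fin_num by [].
have kEsig : semi_sigma_additive kE by exact: dominated_sigma_additive kmu.
pose c := isCharge.Build _ _ _ kE kE0 kEfin kEsig.
pose nu : {charge set T -> \bar R} := HB.pack kE c.
have [P [N [[mP posP] [mN negN] PN PN0]]] := Hahn_decomposition nu.
exists P; split=> //; rewrite -PN kadd// gerDl -lee_fin; exact: negN.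
Qed.

End dominated.

(** * Integrals of bounded functions *)

Section bounded_integrals.
Context d (T : measurableType d) (R : realType).
Variable mu : {finite_measure set T -> \bar R}.
Implicit Types (f : T -> R) (E : set T).

Lemma bounded_integrable f M E : measurable_fun setT f ->
  (forall w, `|f w| <= M) -> measurable E -> mu.-integrable E (EFin \o f).
Proof.
move=> mf fM mE; apply: measurable_bounded_integrable => //.
- by rewrite ltey_eq fin_num_measure.
- exact: measurable_funS mf.
- exists M; split=> [|N MN w _]; first exact: num_real.
  exact: le_trans (fM w) (ltW MN).
Qed.

Lemma cst_integrable (c : R) E : measurable E ->
  mu.-integrable E (EFin \o (cst c : T -> R)).
Proof.
by move=> mE; apply: (@bounded_integrable _ `|c|) => //; exact: measurable_cst.
Qed.

Lemma Rintegral_ge f M (c : R) E : measurable_fun setT f ->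
  (forall w, `|f w| <= M) -> measurable E -> (forall w, E w -> c <= f w) ->
  c * fine (mu E) <= \int[mu]_(w in E) f w.
Proof.
move=> mf fM mE cf; rewrite -Rintegral_cst//; apply: le_Rintegral => //.
  exact: cst_integrable.
exact: bounded_integrable fM mE.
Qed.

Lemma Rintegral_le f M (c : R) E : measurable_fun setT f ->
  (forall w, `|f w| <= M) -> measurable E -> (forall w, E w -> f w <= c) ->
  \int[mu]_(w in E) f w <= c * fine (mu E).
Proof.
move=> mf fM mE cf; rewrite -Rintegral_cst//; apply: le_Rintegral => //.
  exact: bounded_integrable fM mE.
exact: cst_integrable.
Qed.

Lemma Rintegral_normr_le f M E : measurable_fun setT f ->
  (forall w, `|f w| <= M) -> measurable E ->
  `|\int[mu]_(w in E) f w| <= M * fine (mu E).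
Proof.
move=> mf fM mE; rewrite ler_norml -mulNr (Rintegral_le (M := M))//.
  rewrite andbT (Rintegral_ge (M := M))// => w _.
  by have := fM w; rewrite ler_norml => /andP[].
by move=> w _; rewrite (le_trans (ler_norm _)).
Qed.

Lemma Rintegral_finitely_additive f M : measurable_fun setT f ->
  (forall w, `|f w| <= M) -> finitely_additive (fun E => \int[mu]_(w in E) f w).
Proof.
move=> mf fM A B mA mB AB; rewrite Rintegral_setU//; last exact/disj_set2P.
by apply: bounded_integrable fM _ => //; exact: measurableU.
Qed.

Lemma measure_bigcup0 (F : nat -> set T) : (forall i, measurable (F i)) ->
  (forall i, mu (F i) = 0%E) -> mu (\bigcup_i F i) = 0%E.
Proof.
move=> mF F0; apply/negligibleP; first by apply: bigcup_measurable => i _.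
by apply: negligible_bigcup => i; apply/negligibleP => //; exact: F0.
Qed.

Lemma fine_measure_gt0 E : measurable E -> (0 < fine (mu E)) = (mu E != 0%E).
Proof.
by move=> mE; rewrite lt0r fine_ge0// andbT fine_eq0// fin_num_measure.
Qed.

End bounded_integrals.

(** * Sets all of whose relatively open pieces have positive measure *)

Section essential_part.
Context {R : realType} {Omega : pointedMetricType R}.
Local Notation borel := (@borel R Omega).
Variable mu : {finite_measure set borel -> \bar R}.

(** Remove from [E] the open sets whose trace on [E] is null. Countably many of them cover the
    others, so the removed part is null. *)
Lemma measure_essential_part (E : set borel) : @second_countable Omega ->
  measurable E -> mu E != 0%E ->
  exists E0 : set borel, [/\ measurable E0, E0 `<=` E, E0 !=set0 &
    forall U, open U -> U `&` E0 !=set0 -> mu (U `&` E0) != 0%E].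
Proof.
move=> sc mE muE.
pose null (U : set Omega) := mu.-negligible (U `&` E).
have [||V [VP Vmax]] := @second_countable_union Omega null sc.
- by move=> U V UV; apply: negligibleS; exact: setSI.
- by rewrite /null set0I; exact: negligible_set0.
pose W := \bigcup_i V i.
have oW : open W by apply: bigcup_open => i _; case: (VP i).
have nW : mu.-negligible (W `&` E).
  by rewrite setI_bigcupl; apply: negligible_bigcup => i; case: (VP i).
have mE0 : measurable (E `\` W : set borel).
  by apply: measurableD => //; exact: open_borel.
exists (E `\` W); split=> //.
- apply/set0P/eqP => E0; move/eqP: muE; apply; apply/negligibleP => //.
  apply: negligibleS nW => w Ew; split=> //; apply: contrapT => Ww.
  by have : set0 w by rewrite -E0.
- move=> U oU [w [Uw [Ew Ww]]]; apply/eqP => U0; apply: Ww.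
  apply: (Vmax U) => //.
  have nU : mu.-negligible (U `&` (E `\` W)).
    by apply/negligibleP => //; apply: measurableI => //; exact: open_borel.
  apply: negligibleS (negligibleU nU nW) => v [Uv Ev].
  by have [Wv|Wv] := pselect (W v); [right|left].
Qed.

End essential_part.

(** * The integral formula for [P (pmeas cO mu)] *)

Section tame_integral.
Context {R : realType} {Omega : pointedMetricType R}.
Context (cO : compact [set: Omega]) (phi : continuousType Omega Omega).
Local Notation X := (contfun R cO).
Local Notation borel := (@borel R Omega).
Variable P : blin (dual X) (dual X).
Hypotheses (tm : tame cO phi) (GP : Gamma phi P).
Variable mu : probability borel R.
Local Notation p := (pi_map phi P).
Implicit Types (x : X) (E : set borel).

Lemma Rintegral_contfun_le x E : measurable E ->
  `|\int[mu]_(w in E) (x : borel -> R) w| <= supnorm x * fine (mu E).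
Proof.
move=> mE; apply: (@Rintegral_normr_le _ _ _ mu (x : borel -> R)) => //.
  exact: measurable_contfun.
exact: supnorm_ub.
Qed.

(** Measurability stands under the existential, with default 0, so that choice yields one map [r] on
    all sets. *)
Lemma restricted_functional E :
  exists y : dual X, measurable E -> forall x, y x = \int[mu]_(w in E) x w.
Proof.
have [mE|nE] := pselect (measurable E); last by exists 0.
have ix x : mu.-integrable E (EFin \o (x : borel -> R)).
  apply: (@bounded_integrable _ _ _ mu (x : borel -> R) (supnorm x)) => //.
    exact: measurable_contfun.
  exact: supnorm_ub.
have lin : linear ((fun x : X => \int[mu]_(w in E) (x : borel -> R) w) : X -> R^o).
  move=> a x y.
  transitivity (a * \int[mu]_(w in E) (x : borel -> R) w +
                \int[mu]_(w in E) (y : borel -> R) w); last by [].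
  by rewrite -RintegralZl// -RintegralD//; exact: (ix (a *: x)).
have bnd : exists M : R, forall x,
    `|\int[mu]_(w in E) (x : borel -> R) w : R^o| <= M * `|x|.
  exists (fine (mu E)) => x; rewrite mulrC.
  exact: Rintegral_contfun_le.
by exists (Blin lin bnd).
Qed.

(* Otherwise [P mu x] exceeds the integral of [x \o p] by a fixed proportion of
   the measure on all subsets of some [E] on which [x \o p] is nearly constant,
   and the sequence [x \o phi^n] alternates on the essential part of [E]. *)
Lemma integral_pi_le x : P (pmeas cO mu) x <= \int[mu]_w (x \o p) w.
Proof.
have /choice[r rP] := restricted_functional.
have pmeasE : pmeas cO mu = r setT.
  apply: blinP => y; rewrite rP//.
  exact: (cintegral_measure mu (y : borel -> R)).
rewrite pmeasE leNgt; apply/negP; set I := \int[mu]_w _ => gap.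
set f := x \o p in I gap.
have mf : measurable_fun [set: borel] (f : borel -> R).
  exact: measurable_contfun_pi tm GP x.
have fM w : `|f w| <= supnorm x by exact: supnorm_ub.
pose m E := fine (mu E).
have m_add : finitely_additive m by exact: finitely_additive_fine.
have f_add : finitely_additive (fun E => \int[mu]_(w in E) f w).
  exact: (@Rintegral_finitely_additive _ _ _ mu (f : borel -> R)
    (supnorm x) mf fM).
(* Linearity of [P] makes [L] finitely additive, and its boundedness makes [L] dominated by [mu]. *)
pose L E := P (r E) x.
have L_add : finitely_additive L.
  move=> A B mA mB AB; rewrite /L (_ : r (A `|` B) = r A + r B).
    by rewrite linearD.
  apply: blinP => y; rewrite rP; last exact: measurableU.
  transitivity (r A y + r B y); last by [].
  rewrite !rP//; apply: (@Rintegral_finitely_additive _ _ _ mu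
    (y : borel -> R) (supnorm y)) => //.
    exact: measurable_contfun.
  exact: supnorm_ub.
have L_le E : measurable E -> `|L E| <= (`|P| * supnorm x) * m E.
  move=> mE; rewrite (le_trans (le_opnorm (P (r E)) x))//.
  rewrite mulrAC ler_wpM2r ?supnorm_ge0// (le_trans (le_opnorm P (r E)))//.
  rewrite ler_wpM2l ?opnorm_ge0//; apply: opnorm_le; first exact: fine_ge0.
  move=> y; rewrite rP// mulrC.
  exact: Rintegral_contfun_le.
(* Half the gap: as [mu] has mass 1, [k setT] below equals [c], hence is positive. *)
pose c := (L setT - I) / 2.
have c0 : 0 < c by rewrite divr_gt0// subr_gt0.
have mT : m setT = 1 by rewrite /m probability_setT.
pose k E := L E - \int[mu]_(w in E) f w - c * m E.
have k_add : finitely_additive k.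
  by move=> A B mA mB AB; rewrite /k L_add// f_add// m_add//; lra.
have k_le E : measurable E ->
    `|k E| <= (`|P| * supnorm x + supnorm x + c) * m E.
  move=> mE; rewrite !mulrDl (le_trans (ler_normB _ _))// lerD//.
    rewrite (le_trans (ler_normB _ _))// lerD//; first exact: L_le.
    exact: Rintegral_normr_le.
  by rewrite normrM (gtr0_norm c0) ger0_norm// fine_ge0.
have [E [mE kE Epos]] := dominated_positive_set k_add k_le.
have muE : mu E != 0%E.
  apply/eqP => E0; have := k_le _ mE; have : 0 < k E.
    by apply: lt_le_trans kE; rewrite /k mT -/I /c; lra.
  rewrite /m E0/= mulr0 normr_le0 => k0 /eqP k00; by rewrite k00 ltxx in k0.
have c20 : 0 < c / 2 by rewrite divr_gt0.
(* Slice the range of [f] into steps of [c / 2]; countably many slices cover [E], so one is not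
   null. *)
pose lev j := - supnorm x + (c / 2) * j%:R.
pose F j := E `&` f @^-1` `[lev j, lev j.+1[%classic.
have mF j : measurable (F j : set borel).
  apply: measurableI => //; rewrite -[X in measurable X]setTI.
  by apply: mf => //; exact: measurable_itv.
have EF : E = \bigcup_j F j.
  apply/seteqP; split=> [w Ew|w [j _ []//]].
  have g0 : 0 <= (f w + supnorm x) / (c / 2).
    rewrite divr_ge0 ?(ltW c20)//.
    by have := fM w; rewrite ler_norml => /andP[]; lra.
  exists (Num.trunc ((f w + supnorm x) / (c / 2))) => //; split=> //=.
  have := truncn_itv g0; rewrite in_itv/= ler_pdivlMr// ltr_pdivrMr// /lev.
  by move=> /andP[h1 h2]; apply/andP; split; lra.
have [j muF] : exists j, mu (F j) != 0%E.
  apply: contrapT => /forallNP F0; move/eqP: muE; apply; rewrite EF measure_bigcup0// => j.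
  by apply/eqP/negPn/negP; exact: F0.
have sc : @second_countable Omega by exact: compact_second_countable.
have [E0 [mE0 E0F E0n E0U]] := measure_essential_part sc (mF j) muF.
(* On the slice [f >= a - c / 2], and [L] exceeds the integral of [f] by at least [c * m e], so
   [L e >= (a + c / 2) * m e]. The value [c / 4] leaves strict room on both sides. *)
pose a := lev j.+1; pose b := a + c / 4.
have fa w : E0 w -> f w < a.
  by move=> /E0F[_]; rewrite /= in_itv/= => /andP[].
have Lb e : measurable e -> e `<=` E0 -> mu e != 0%E -> b * m e < L e.
  move=> me eE0 mue.
  have me0 : 0 < m e by rewrite /m fine_measure_gt0.
  have : 0 <= k e by apply: Epos => // w /eE0/E0F[].
  have : lev j * m e <= \int[mu]_(w in e) f w.
    apply: (@Rintegral_ge _ _ _ mu (f : borel -> R) (supnorm x) (lev j) e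
      mf fM me) => w /eE0/E0F[_].
    by rewrite /= in_itv/= => /andP[].
  rewrite /k (_ : lev j = a - c / 2); last by rewrite /a /lev -natr1; lra.
  have : 0 < c * m e by rewrite mulr_gt0.
  rewrite /b; lra.
have ab : a < b by rewrite /b; lra.
apply: (tame_not_alternating (x := x) tm ab E0n) => Us mUs.
have /choice[q qP] : forall U : set Omega, exists w, U \in Us -> (U `&` E0) w.
  move=> U; have [/mUs[_ [w Uw]]|UUs] := boolP (U \in Us); first by exists w.
  by exists point.
(* One [n] must satisfy two kinds of conditions: mean above [b] on each piece, and value below [a]
   at a chosen point of each piece. *)
pose l := [seq (r (U `&` E0), b * m (U `&` E0)) | U <- Us] ++
          [seq (- delta cO (q U), - a) | U <- Us].
have mU U : U \in Us -> measurable (U `&` E0 : set borel).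
  by move=> /mUs[oU _]; apply: measurableI => //; exact: open_borel.
have [|n nP] := Gamma_approx (x := x) (l := l) GP.
  move=> s; rewrite mem_cat => /orP[]/mapP[U UUs ->] /=.
  - have [oU UE0] := mUs _ UUs.
    by apply: Lb; [exact: mU|exact: subIsetr|exact: E0U].
  - rewrite linearN/= -[X in _ < X]/(-1 * _) mulN1r ltrN2 (pi_mapP GP).
    by apply: fa; have [] := qP U UUs.
exists n => U s UUs; case: s; last first.
  exists (q U); have [Uq E0q] := qP U UUs; split=> //; split=> //=.
  have : - a < (- delta cO (q U) : dual X) (translate phi x n).
    by apply: (nP (_, _)); rewrite mem_cat; apply/orP; right; apply/mapP; exists U.
  by rewrite -[X in _ < X]/(-1 * _) mulN1r ltrN2 deltaE.
(* A mean above [b] forces a point of the piece with value above [b]. *)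
have : b * m (U `&` E0) < r (U `&` E0) (translate phi x n).
  by apply: (nP (_, _)); rewrite mem_cat map_f.
rewrite rP; last exact: mU.
apply: contraPP => nw; apply/negP; rewrite -leNgt.
apply: (@Rintegral_le _ _ _ mu (translate phi x n : borel -> R)
  (supnorm (translate phi x n))).
- exact: measurable_contfun.
- exact: supnorm_ub.
- exact: mU.
move=> w [Uw E0w]; rewrite leNgt; apply/negP => bw.
by apply: nw; exists w.
Qed.

(** The reverse inequality is [integral_pi_le] applied to [- x]. *)
Lemma integral_pi x : P (pmeas cO mu) x = \int[mu]_w (x \o p) w.
Proof.
apply/eqP; rewrite eq_le integral_pi_le/=.
have := integral_pi_le (- x); rewrite linearN.
have -> : \int[mu]_w ((- x : X) \o p) w = - \int[mu]_w (x \o p) w.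
  rewrite -mulN1r -RintegralZl//.
  apply: (@bounded_integrable _ _ _ mu _ (supnorm x)) => //.
    exact: measurable_contfun_pi tm GP x.
  by move=> w; exact: supnorm_ub.
by rewrite lerN2.
Qed.

End tame_integral.

(** * Regularity of the operators in [Gamma] *)

Theorem corollary2p6 (R : realType) (Omega : pointedMetricType R)
    (cO : compact [set: Omega]) (phi : continuousType Omega Omega) :
  tame cO phi ->
  forall P : blin (dual (contfun R cO)) (dual (contfun R cO)),
    Gamma phi P -> regular phi P.
Proof.
move=> tm P GP; have mp := measurable_pi tm GP; split=> // mu.
(* The required charge is the image of [mu] under [pi_map phi P], and the integral formula becomes a
   change of variables. *)
pose p : {RV mu >-> borel} := HB.pack (pi_map phi P)
  (isMeasurableFun.Build _ _ borel borel (pi_map phi P) mp).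
exists (charge_of_finite_measure (distribution mu p)); split=> //.
apply: blinP => x; rewrite (integral_pi tm GP).
transitivity (\int[distribution mu p]_w (x : borel -> R) w); last first.
  exact/esym/(cintegral_measure (distribution mu p) (x : borel -> R)).
rewrite /Rintegral integral_distribution//.
  by apply/measurable_realfun.measurable_EFinP; exact: measurable_contfun.
apply: (@bounded_integrable _ _ _ mu _ (supnorm x)) => //.
  exact: measurable_contfun_pi tm GP x.
by move=> w; exact: supnorm_ub.
Qed.
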